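(* Let $k$ be a field of characteristic $0$, let $\mathbb r$ be a nc rational function over $k$ in $x_1,\dots,x_g$, regular at the origin, with minimal realization of size $d$, and let $$m=\begin{cases}\lambda(d) & \text{if } k \text{ is an algebraically closed field},\\ 2\lambda(d) & \text{if } k \text{ is a real closed field},\\ d\,\lambda(d)^2 & \text{otherwise.}\end{cases}$$ If $\operatorname{dom}_m\mathbb r=M_m(k)^g$, then $\mathbb r$ is a nc polynomial of degree at most $d-1$.
   Context: $\lambda(1)=1$ and $\lambda(d)=\left\lceil d\sqrt{\frac{2d^2}{d-1}+\frac14}+\frac d2-2\right\rceil$ for $d\ge2$. Let $k\langle x\rangle=k\langle x_1,\dots,x_g\rangle$ be the free $k$-algebra of noncommutative (nc) polynomials. A nc rational expression is a syntactically valid combination of nc polynomials, the operations $+,\cdot,{}^{-1}$ and parentheses. An expression $r$ can be evaluated at $X\in M_n(k)^g$ whenever all inverses appearing in $r$ exist at $X$; $\operatorname{dom}_n r$ is the set of such $X$ and $\operatorname{dom} r=\bigcup_n\operatorname{dom}_n r$. Expressions $r_1,r_2$ with nonempty domains are equivalent if $r_1(X)=r_2(X)$ for all $X\in\operatorname{dom} r_1\cap\operatorname{dom} r_2$. Nc rational functions are the equivalence classes; they form a skew field containing $k\langle x\rangle$. For a nc rational function $\mathbb r$, $\operatorname{dom}_n\mathbb r$ is the union of $\operatorname{dom}_n r$ over all representatives $r$ of $\mathbb r$, and $\operatorname{dom}\mathbb r=\bigcup_n\operatorname{dom}_n\mathbb r$. If $0\in\operatorname{dom}\mathbb r$ ($\mathbb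 r$ is regular at the origin), a realization of $\mathbb r$ of size $d$ is a triple $(\mathbf c,L,\mathbf b)$ with $\mathbf b,\mathbf c\in k^d$ and $L=I_d-\sum_iA_ix_i$, $A_i\in M_d(k)$, such that $\mathbb r=\mathbf c^tL^{-1}\mathbf b$; every such $\mathbb r$ has a realization. A realization of smallest size among all realizations of $\mathbb r$ is called minimal. *)

(* Defs.v *)
From HB Require Import structures.
From mathcomp Require Import all_boot all_order all_algebra.
From mathcomp Require Import finmap realalg monalg boolp.

Set Implicit Arguments.
Unset Strict Implicit.
Unset Printing Implicit Defensive.

Import Order.TTheory GRing.Theory Num.Theory.
Local Open Scope ring_scope.

(* The value at d = 0 is junk: sizes of realizations are positive below.
   The ceiling is nonnegative for d >= 2, so the absolute value only casts
   int to nat. *)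
Definition lambda (d : nat) : nat :=
  if (d <= 1)%N then 1%N else
  absz (Num.ceil (d%:R * Num.sqrt (2 * d%:R ^+ 2 / (d%:R - 1) + 1 / 4)
                  + d%:R / 2 - 2 : realalg)).

(* A fieldType carries no order: k is real closed when it is isomorphic, as a
   ring, to an ordered field with the intermediate value property for
   polynomials. *)
Definition real_closed_field (k : fieldType) : Prop :=
  exists (R : rcfType) (f : {rmorphism k -> R}), bijective f.

Definition test_size (k : fieldType) (d : nat) : nat :=
  if `[< GRing.closed_field_axiom k >] then lambda d
  else if `[< real_closed_field k >] then (2 * lambda d)%N
  else (d * lambda d ^ 2)%N.

Section NCRational.
Variables (k : fieldType) (g : nat).

(* The free algebra, as the algebra of the free monoid of words in 'I_g. *)
Definition ncpoly := {malg k[{fmonom 'I_g}]}.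

(* mmeasure is 1 + degree, and 0 for the zero polynomial. *)
Definition ncdeg (p : ncpoly) : nat := (mmeasure (@fdeg 'I_g) p).-1.

Inductive ncexpr :=
| NCPoly of ncpoly
| NCAdd of ncexpr & ncexpr
| NCMul of ncexpr & ncexpr
| NCInv of ncexpr.

Definition ncpoly_eval n (X : 'I_g -> 'M[k]_n) (p : ncpoly) : 'M[k]_n :=
  \sum_(w <- msupp p) p@_w *: \prod_(i <- (w : seq 'I_g)) X i.

(* None when some inverse occurring in the expression does not exist at X. *)
Fixpoint nceval n (X : 'I_g -> 'M[k]_n) (r : ncexpr) : option 'M[k]_n :=
  match r with
  | NCPoly p => Some (ncpoly_eval X p)
  | NCAdd r1 r2 =>
      if (nceval X r1, nceval X r2) is (Some A, Some B)
      then Some (A + B) else None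
  | NCMul r1 r2 =>
      if (nceval X r1, nceval X r2) is (Some A, Some B)
      then Some (A *m B) else None
  | NCInv r1 =>
      if nceval X r1 is Some A
      then if A \in unitmx then Some (invmx A) else None
      else None
  end.

Definition expr_dom n (r : ncexpr) (X : 'I_g -> 'M[k]_n) : bool :=
  isSome (nceval X r).

(* Matrices of size 0 have to be excluded: every expression is defined there. *)
Definition nondegenerate (r : ncexpr) : Prop :=
  exists n (X : 'I_g -> 'M[k]_n), (0 < n)%N /\ expr_dom r X.

Definition nceq (r1 r2 : ncexpr) : Prop :=
  [/\ nondegenerate r1, nondegenerate r2 &
    forall n (X : 'I_g -> 'M[k]_n), (0 < n)%N ->
      expr_dom r1 X -> expr_dom r2 X -> nceval X r1 = nceval X r2].

Record ncratfun := NCRatFun {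
  represents :> ncexpr -> Prop;
  represents_class :
    exists2 r, nondegenerate r & forall s, represents s <-> nceq r s
}.

Definition ratfun_dom n (F : ncratfun) (X : 'I_g -> 'M[k]_n) : Prop :=
  exists2 r, F r & expr_dom r X.

Definition regular_at_origin (F : ncratfun) : Prop :=
  ratfun_dom F (fun _ : 'I_g => 0 : 'M[k]_1).

Definition pencil d (A : 'I_g -> 'M[k]_d) : 'M[ncpoly]_d :=
  \matrix_(i, j) ((i == j)%:R - \sum_(l < g) << A l i j *g fmu l >>).

Definition ncsum d (u : 'I_d -> ncexpr) : ncexpr :=
  \big[NCAdd/NCPoly 0]_(i < d) u i.

(* M is a two-sided inverse of L in the d x d matrices over the skew field of
   nc rational functions; the entries of M are given by representatives. *)
Definition inverse_matrix d (L : 'M[ncpoly]_d) (M : 'I_d -> 'I_d -> ncexpr) :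
    Prop :=
  forall i j,
    nceq (ncsum (fun l => NCMul (NCPoly (L i l)) (M l j)))
         (NCPoly (i == j)%:R) /\
    nceq (ncsum (fun l => NCMul (M i l) (NCPoly (L l j))))
         (NCPoly (i == j)%:R).

Definition realization d (F : ncratfun)
    (c : 'cV[k]_d) (A : 'I_g -> 'M[k]_d) (b : 'cV[k]_d) : Prop :=
  (0 < d)%N /\
  exists2 M : 'I_d -> 'I_d -> ncexpr, inverse_matrix (pencil A) M &
    F (ncsum (fun i => ncsum (fun j =>
         NCMul (NCMul (NCPoly (c i 0)%:MP) (M i j)) (NCPoly (b j 0)%:MP)))).

Definition minimal_realization d (F : ncratfun)
    (c : 'cV[k]_d) (A : 'I_g -> 'M[k]_d) (b : 'cV[k]_d) : Prop :=
  realization F c A b /\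
  forall e (c' : 'cV[k]_e) (A' : 'I_g -> 'M[k]_e) (b' : 'cV[k]_e),
    realization F c' A' b' -> (d <= e)%N.

End NCRational.

(* Main.v *)
Require Import Defs.
From HB Require Import structures.
From mathcomp Require Import all_boot all_order all_algebra.
From mathcomp Require Import finmap realalg monalg boolp ring lra.

(** Put D_s = A_s^T. Instead of on column vectors, let the pencil at X act on
M_(n, d) by V |-> V - sum_s X_s V D_s; then r(X) w = V c whenever
V - sum_s X_s V D_s = w b^T, so long as this operator is invertible. Restricting
to a subspace and passing to a quotient makes the triple controllable and
observable.

Let W be a subspace of row vectors with W = sum_s W D_s, and p a projection
onto W. Then p = sum_s X_s p D_s for suitable d x d matrices X_s, while
controllability yields Y_s with 1 = w b^T + sum_s Y_s D_s. On the line from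
Y (1 - p) + X to Y the solution of the pencil equation is 1 - p + p / t, so the
value of the function at w has residue p c at t = 0. As some representative is
defined there, p c = 0, and W = 0 by observability. So test size d is already
enough, over any infinite field: the descending chain k^d, sum_s k^d D_s, ...
stabilizes at such a W, hence reaches 0 in at most d steps, all words of length d in
the A_s vanish, and the power series of the function is a polynomial of degree
less than d. *)

Set Implicit Arguments.
Unset Strict Implicit.
Unset Printing Implicit Defensive.

Import Order.TTheory GRing.Theory Num.Theory.
Local Open Scope ring_scope.

(** * Evaluation of expressions *)

Section Evaluation.
Variables (k : fieldType) (g : nat).
Implicit Types (r : ncexpr k g) (p : ncpoly k g).

Lemma ncpoly_eval_zmod_morphism n (X : 'I_g -> 'M[k]_n) :
  zmod_morphism (ncpoly_eval X).
Proof.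
(* In size 0 all matrices coincide; in positive size evaluation is an instance of [mmap]. *)
case: n X => [|n] X p q; first by rewrite [LHS]flatmx0 [RHS]flatmx0.
have E s : ncpoly_eval X s =
    mmap (@scalar_mx k n.+1) (fun w : {fmonom 'I_g} => \prod_(i <- (w : seq _)) X i) s.
  by apply: eq_bigr => w _; rewrite -mul_scalar_mx.
by rewrite !E mmapB.
Qed.

HB.instance Definition _ n (X : 'I_g -> 'M[k]_n) :=
  GRing.isZmodMorphism.Build (ncpoly k g) 'M[k]_n (ncpoly_eval X)
    (ncpoly_eval_zmod_morphism X).

Lemma ncpoly_evalU n (X : 'I_g -> 'M[k]_n) a (w : {fmonom 'I_g}) :
  ncpoly_eval X << a *g w >> = a *: \prod_(i <- (w : seq 'I_g)) X i.
Proof.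
rewrite /ncpoly_eval msuppU; case: (a =P 0) => [->|_].
  by rewrite big_seq_fset0 scale0r.
by rewrite big_seq_fset1 mcoeffU eqxx mulr1n.
Qed.

Lemma ncpoly_evalC n (X : 'I_g -> 'M[k]_n) a : ncpoly_eval X a%:MP = a%:M.
Proof. by rewrite ncpoly_evalU fm1 big_nil scalemx1. Qed.

Lemma ncpoly_eval_bool n (X : 'I_g -> 'M[k]_n) (e : bool) :
  ncpoly_eval X e%:R = e%:R%:M.
Proof. by rewrite -mpolyC_nat ncpoly_evalC. Qed.

Lemma ncpoly_eval_pencil d (A : 'I_g -> 'M[k]_d) n (X : 'I_g -> 'M[k]_n) i j :
  ncpoly_eval X (pencil A i j) = (i == j)%:R%:M - \sum_s A s i j *: X s.
Proof.
rewrite mxE raddfB [X in _ - X]raddf_sum /= ncpoly_eval_bool; congr (_ - _).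
by apply: eq_bigr => s _; rewrite ncpoly_evalU fmU big_seq1.
Qed.

(** Used to recover the values of the entries of the inverse matrix from a value of the realization
    expression. *)
Lemma nceval_ncsumE n (X : 'I_g -> 'M[k]_n) d (u : 'I_d -> ncexpr k g) B :
  nceval X (ncsum u) = Some B ->
  exists2 v : 'I_d -> 'M[k]_n, forall i, nceval X (u i) = Some (v i)
    & B = \sum_i v i.
Proof.
rewrite /ncsum => EB.
suff H s : forall C, nceval X (\big[@NCAdd k g/NCPoly 0]_(i <- s) u i) = Some C ->
    (forall i, i \in s -> nceval X (u i) != None) /\
    C = \sum_(i <- s) odflt 0 (nceval X (u i)).
  have [Hd ->] := H _ _ EB; exists (fun i => odflt 0 (nceval X (u i))) => // i.
  by have := Hd i (mem_index_enum i); case: (nceval X (u i)).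
elim: s => [C|i s IHs C]; first by rewrite !big_nil /= raddf0 => -[<-].
rewrite !big_cons /=; case Ei: (nceval X (u i)) => [Ci|] //=.
case Es: (nceval _ _) => [Cs|] // [<-]; have [Hd <-] := IHs _ Es.
by split=> // j /predU1P[->|/Hd//]; rewrite Ei.
Qed.

Lemma nceval_ncsum n (X : 'I_g -> 'M[k]_n) d (u : 'I_d -> ncexpr k g) v :
  (forall i, nceval X (u i) = Some (v i)) ->
  nceval X (ncsum u) = Some (\sum_i v i).
Proof.
move=> Hu; rewrite /ncsum; elim: (index_enum _) => [|i s IHs].
  by rewrite !big_nil /= raddf0.
by rewrite !big_cons /= Hu IHs.
Qed.

Definition dsum n1 n2 (X : 'I_g -> 'M[k]_n1) (Y : 'I_g -> 'M[k]_n2) s :=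
  block_mx (X s) 0 0 (Y s).

Lemma nceval_dsum n1 n2 (X : 'I_g -> 'M[k]_n1) (Y : 'I_g -> 'M[k]_n2) r P Q :
  nceval X r = Some P -> nceval Y r = Some Q ->
  nceval (dsum X Y) r = Some (block_mx P 0 0 Q).
Proof.
elim: r P Q => [p|r1 IH1 r2 IH2|r1 IH1 r2 IH2|r1 IH1] P Q /=.
- move=> [<-] [<-]; congr Some; rewrite /ncpoly_eval.
  elim: (enum_fset (msupp p)) => [|w s IHs].
    by rewrite !big_nil -block_mx0.
  rewrite !big_cons IHs.
  suff ->: \prod_(i <- (w : seq _)) dsum X Y i =
      block_mx (\prod_(i <- (w : seq _)) X i) 0 0 (\prod_(i <- (w : seq _)) Y i).
    by rewrite scale_block_mx add_block_mx !scaler0 !addr0.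
  elim: (w : seq _) => [|i l IHl]; first by rewrite !big_nil -scalar_mx_block.
  rewrite !big_cons IHl /dsum -!mulmxE mulmx_block.
  by rewrite !mulmx0 !mul0mx !addr0 !add0r.
- case E1: (nceval X r1) => [P1|] //; case E2: (nceval X r2) => [P2|] // [<-].
  case F1: (nceval Y r1) => [Q1|] //; case F2: (nceval Y r2) => [Q2|] // [<-].
  by rewrite (IH1 _ _ E1 F1) (IH2 _ _ E2 F2) add_block_mx !addr0.
- case E1: (nceval X r1) => [P1|] //; case E2: (nceval X r2) => [P2|] // [<-].
  case F1: (nceval Y r1) => [Q1|] //; case F2: (nceval Y r2) => [Q2|] // [<-].
  rewrite (IH1 _ _ E1 F1) (IH2 _ _ E2 F2) mulmx_block.
  by rewrite !mulmx0 !mul0mx !addr0 !add0r.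
- case E1: (nceval X r1) => [P1|] //; case: ifP => // UP [<-].
  case F1: (nceval Y r1) => [Q1|] //; case: ifP => // UQ [<-].
  have UPQ : block_mx P1 0 0 Q1 \in unitmx by rewrite block_diag_mx_unit UP.
  by rewrite (IH1 _ _ E1 F1) UPQ invmx_block_diag.
Qed.

Lemma expr_dom_dsum n1 n2 (X : 'I_g -> 'M[k]_n1) (Y : 'I_g -> 'M[k]_n2) r :
  expr_dom r X -> expr_dom r Y -> expr_dom r (dsum X Y).
Proof.
rewrite /expr_dom; case EX: (nceval X r) => [P|] // _.
by case EY: (nceval Y r) => [Q|] // _; rewrite (nceval_dsum EX EY).
Qed.

(** For an inverse, [Q1 *m E = E *m P1] with [Q1] and [P1] invertible can be multiplied by the
    inverses on both sides. This compares a point with a direct sum of copies of it. *)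
Lemma nceval_intertwine n n' (X : 'I_g -> 'M[k]_n) (X' : 'I_g -> 'M[k]_n')
    (E : 'M[k]_(n', n)) r P P' :
  (forall s, X' s *m E = E *m X s) ->
  nceval X r = Some P -> nceval X' r = Some P' -> P' *m E = E *m P.
Proof.
move=> HE; elim: r P P' => [p|r1 IH1 r2 IH2|r1 IH1 r2 IH2|r1 IH1] P P' /=.
- move=> [<-] [<-]; rewrite mulmx_suml mulmx_sumr; apply: eq_bigr => w _.
  rewrite -scalemxAl -scalemxAr; congr (_ *: _).
  elim: (w : seq _) => [|i l IHl]; first by rewrite !big_nil mul1mx mulmx1.
  by rewrite !big_cons -!mulmxE -mulmxA IHl !mulmxA HE.
- case E1: (nceval X r1) => [P1|] //; case E2: (nceval X r2) => [P2|] // [<-].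
  case F1: (nceval X' r1) => [Q1|] //; case F2: (nceval X' r2) => [Q2|] // [<-].
  by rewrite mulmxDl mulmxDr (IH1 _ _ E1 F1) (IH2 _ _ E2 F2).
- case E1: (nceval X r1) => [P1|] //; case E2: (nceval X r2) => [P2|] // [<-].
  case F1: (nceval X' r1) => [Q1|] //; case F2: (nceval X' r2) => [Q2|] // [<-].
  by rewrite -mulmxA (IH2 _ _ E2 F2) !mulmxA (IH1 _ _ E1 F1).
- case E1: (nceval X r1) => [P1|] //; case: ifP => // UP [<-].
  case F1: (nceval X' r1) => [Q1|] //; case: ifP => // UQ [<-].
  by rewrite -[E in LHS](mulmxK UP) -(IH1 _ _ E1 F1) !mulmxA mulVmx // mul1mx.
Qed.

Definition line n (X Y : 'I_g -> 'M[k]_n) (t : k) s := X s + t *: (Y s - X s).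

Lemma line0 n (X Y : 'I_g -> 'M[k]_n) : line X Y 0 = X.
Proof. by apply: funext => s; rewrite /line scale0r addr0. Qed.

Lemma line1 n (X Y : 'I_g -> 'M[k]_n) : line X Y 1 = Y.
Proof. by apply: funext => s; rewrite /line scale1r addrC subrK. Qed.

Local Notation "P @[ t ]" := (map_mx (horner_eval t) P)
  (at level 2, left associativity, format "P @[ t ]").

(** Along a line the value is a matrix of rational functions of [t]. A common denominator, nonzero
    at [t0], is carried through the expression. *)
Lemma nceval_line n (X Y : 'I_g -> 'M[k]_n) r t0 :
  expr_dom r (line X Y t0) ->
  exists (q : {poly k}) (P : 'M[{poly k}]_n), q.[t0] != 0 /\
    forall t, q.[t] != 0 -> nceval (line X Y t) r = Some (q.[t]^-1 *: P@[t]).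
Proof.
rewrite /expr_dom; elim: r => [p|r1 IH1 r2 IH2|r1 IH1 r2 IH2|r1 IH1] /=.
- pose Z s : 'M_n := map_mx polyC (X s) + 'X *: map_mx polyC (Y s - X s).
  exists 1, (\sum_(w <- msupp p) (p@_w)%:P *: \prod_(i <- (w : seq 'I_g)) Z i).
  split=> [|t _]; first by rewrite hornerC oner_eq0.
  rewrite hornerC invr1 scale1r map_mx_sum; congr Some; apply: eq_bigr => w _.
  rewrite map_mxZ /= horner_evalE hornerC; congr (_ *: _).
  elim: (w : seq _) => [|i l IHl]; first by rewrite !big_nil map_mx1.
  rewrite !big_cons -!mulmxE map_mxM -IHl; congr (_ *m _).
  by apply/matrixP => a b; rewrite !mxE /= horner_evalE hornerD hornerM hornerX !hornerC.
- case E1: (nceval _ r1) IH1 => [C1|] // /(_ isT) [q1 [P1 [Hq1 H1]]].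
  case E2: (nceval _ r2) IH2 => [C2|] // /(_ isT) [q2 [P2 [Hq2 H2]]] _.
  exists (q1 * q2), (q2 *: P1 + q1 *: P2); split.
    by rewrite hornerM mulf_neq0.
  move=> t; rewrite hornerM mulf_eq0 negb_or => /andP[N1 N2].
  rewrite (H1 _ N1) (H2 _ N2) map_mxD !map_mxZ /= !horner_evalE scalerDr !scalerA.
  congr Some; rewrite invfM -[X in _ = X *: _ + _]mulrA mulVf // mulr1.
  by rewrite [X in _ = _ + X *: _]mulrAC mulVf // mul1r.
- case E1: (nceval _ r1) IH1 => [C1|] // /(_ isT) [q1 [P1 [Hq1 H1]]].
  case E2: (nceval _ r2) IH2 => [C2|] // /(_ isT) [q2 [P2 [Hq2 H2]]] _.
  exists (q1 * q2), (P1 *m P2); split; first by rewrite hornerM mulf_neq0.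
  move=> t; rewrite hornerM mulf_eq0 negb_or => /andP[N1 N2].
  rewrite (H1 _ N1) (H2 _ N2) map_mxM /=.
  by rewrite -scalemxAl -scalemxAr scalerA invfM.
- case E1: (nceval _ r1) IH1 => [C1|] // /(_ isT) [q [P [Hq H]]].
  move: E1; rewrite (H _ Hq) => -[<-]; case: ifP => // U _.
  (* By Cramer's rule the inverse of [P / q] is [q * \adj P / \det P]; the factor [q] is kept in the
     denominator so that its nonzeros stay within the domain. *)
  exists (q * \det P), (q ^+ 2 *: \adj P); split.
    rewrite hornerM mulf_neq0 //; move: U.
    rewrite unitmxE detZ unitrM => /andP[_]; rewrite unitfE.
    by rewrite det_map_mx.
  move=> t; rewrite hornerM mulf_eq0 negb_or => /andP[N1 N2].
  have UP : P@[t] \in unitmx by rewrite unitmxE unitfE det_map_mx.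
  rewrite (H _ N1) unitmxZ ?unitfE ?invr_eq0 // UP; congr Some.
  rewrite invmxZ ?unitmxZ ?unitfE ?invr_eq0 // invrK /invmx UP.
  rewrite map_mxZ map_mx_adj /= det_map_mx !horner_evalE !scalerA.
  congr (_ *: _); rewrite invfM horner_exp expr2; move: N1 N2.
  by set a := q.[t]; set b := _.[t]; move=> a0 b0; rewrite mulrACA mulVf ?mul1r // mulrC.
Qed.

End Evaluation.
(** * The pencil as an operator *)

Section Pencil.
Variables (k : fieldType) (g : nat).

Local Notation "P @[ t ]" := (map_mx (horner_eval t) P)
  (at level 2, left associativity, format "P @[ t ]").

(** After vectorization this is a sum of Kronecker products of the [X s] with the transposes of the
    [D s]. *)
Definition sylv n d (X : 'I_g -> 'M[k]_n) (D : 'I_g -> 'M[k]_d) (V : 'M[k]_(n, d)) :=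
  \sum_s X s *m V *m D s.

(* [id - sylv X D] is the linear pencil at X, acting on M_(n, d) instead of on
   column vectors of length d * n; there D is the transpose of A. *)
Definition pencil_inj n d (X : 'I_g -> 'M[k]_n) (D : 'I_g -> 'M[k]_d) :=
  forall V : 'M[k]_(n, d), V = sylv X D V -> V = 0.

Fact sylv_linear n d (X : 'I_g -> 'M[k]_n) (D : 'I_g -> 'M[k]_d) :
  linear (sylv X D).
Proof.
move=> a U V; rewrite /sylv scaler_sumr -big_split; apply: eq_bigr => s _ /=.
by rewrite mulmxDr mulmxDl -scalemxAr -scalemxAl.
Qed.

HB.instance Definition _ n d X D :=
  GRing.isLinear.Build k 'M[k]_(n, d) 'M[k]_(n, d) _ (sylv X D) (sylv_linear X D).

Definition pencil_map n d X D (V : 'M[k]_(n, d)) := V - sylv X D V.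

Fact pencil_map_linear n d (X : 'I_g -> 'M[k]_n) (D : 'I_g -> 'M[k]_d) :
  linear (pencil_map X D).
Proof.
by move=> a U V; rewrite /pencil_map linearP scalerBr opprD addrACA.
Qed.

HB.instance Definition _ n d X D :=
  GRing.isLinear.Build k 'M[k]_(n, d) 'M[k]_(n, d) _ (pencil_map X D)
    (pencil_map_linear X D).

Definition pencil_mx n d (X : 'I_g -> 'M[k]_n) (D : 'I_g -> 'M[k]_d) :=
  lin_mx (pencil_map X D).

Lemma pencil_injP n d (X : 'I_g -> 'M[k]_n) (D : 'I_g -> 'M[k]_d) :
  pencil_inj X D <-> pencil_mx X D \in unitmx.
Proof.
split=> [inj|U V EV].
  rewrite -row_free_unit; apply: inj_row_free => v.
  rewrite -[v]vec_mxK mul_vec_lin => /(canRL mxvecK) /eqP.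
  rewrite linear0 subr_eq0 => /eqP /inj ->.
  by rewrite linear0.
apply: (can_inj mxvecK); apply: (can_inj (mulmxK U)).
by rewrite mul_vec_lin /= /pencil_map -EV subrr !linear0 mul0mx.
Qed.

Lemma pencil_surj n d (X : 'I_g -> 'M[k]_n) (D : 'I_g -> 'M[k]_d) :
  pencil_inj X D -> forall U, exists V, V = U + sylv X D V.
Proof.
move=> /pencil_injP inj U; exists (vec_mx (mxvec U *m invmx (pencil_mx X D))).
set V := vec_mx _; suff: pencil_map X D V = U by move=> <-; rewrite subrK.
by apply: (can_inj mxvecK); rewrite -mul_vec_lin vec_mxK mulmxKV.
Qed.

Lemma pencil_surj_inj n d (X : 'I_g -> 'M[k]_n) (D : 'I_g -> 'M[k]_d) :
  (forall U, exists V, V = U + sylv X D V) -> pencil_inj X D.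
Proof.
move=> surj; apply/pencil_injP; rewrite -row_full_unit -sub1mx.
apply/row_subP => i; have [V EV] := surj (vec_mx (row i 1%:M)).
suff <- : mxvec V *m pencil_mx X D = row i 1%:M by exact: submxMl.
by rewrite mul_vec_lin /= /pencil_map {1}EV addrK vec_mxK.
Qed.

Lemma pencil_uniq n d (X : 'I_g -> 'M[k]_n) (D : 'I_g -> 'M[k]_d) U V V' :
  pencil_inj X D -> V = U + sylv X D V -> V' = U + sylv X D V' -> V = V'.
Proof.
move=> inj EV EV'; apply/eqP; rewrite -subr_eq0; apply/eqP/inj.
by rewrite linearB {1}EV {1}EV' /= opprD addrACA subrr add0r.
Qed.

Lemma sylv_dsum n1 n2 d (X : 'I_g -> 'M[k]_n1) (Y : 'I_g -> 'M[k]_n2)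
    (D : 'I_g -> 'M[k]_d) U V :
  sylv (dsum X Y) D (col_mx U V) = col_mx (sylv X D U) (sylv Y D V).
Proof.
rewrite /sylv.
elim/big_rec3: _ => [|s A B C _ ->]; first by rewrite col_mx0.
by rewrite -add_col_mx mul_block_col !mul0mx add0r addr0 mul_col_mx.
Qed.

Lemma pencil_inj_dsum n1 n2 d (X : 'I_g -> 'M[k]_n1) (Y : 'I_g -> 'M[k]_n2)
    (D : 'I_g -> 'M[k]_d) :
  pencil_inj X D -> pencil_inj Y D -> pencil_inj (dsum X Y) D.
Proof.
move=> iX iY V; rewrite -[V]vsubmxK sylv_dsum.
by move=> /eq_col_mx[/iX -> /iY ->]; rewrite col_mx0.
Qed.

Lemma sylv_intertwine n n' d (X : 'I_g -> 'M[k]_n) (X' : 'I_g -> 'M[k]_n')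
    (D : 'I_g -> 'M[k]_d) (E : 'M[k]_(n', n)) V :
  (forall s, X' s *m E = E *m X s) -> sylv X' D (E *m V) = E *m sylv X D V.
Proof.
by move=> HE; rewrite mulmx_sumr; apply: eq_bigr => s _; rewrite !mulmxA HE.
Qed.

Lemma sylvM n d d' (X : 'I_g -> 'M[k]_n) (D : 'I_g -> 'M[k]_d)
    (D' : 'I_g -> 'M[k]_d') (Q : 'M[k]_(d, d')) V :
  (forall s, D s *m Q = Q *m D' s) -> sylv X D' (V *m Q) = sylv X D V *m Q.
Proof.
by move=> HQ; rewrite mulmx_suml; apply: eq_bigr => s _; rewrite -!mulmxA HQ.
Qed.

Lemma sylv_line n d (X Y : 'I_g -> 'M[k]_n) (D : 'I_g -> 'M[k]_d) t V :
  sylv (line X Y t) D V = sylv X D V + t *: (sylv Y D V - sylv X D V).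
Proof.
rewrite -sumrB scaler_sumr -big_split; apply: eq_bigr => s _ /=.
by rewrite /line !mulmxDl -!scalemxAl mulmxBl mulmxBl.
Qed.

Lemma pencil_mx_line n d (X Y : 'I_g -> 'M[k]_n) (D : 'I_g -> 'M[k]_d) t :
  pencil_mx (line X Y t) D =
  pencil_mx X D + t *: (pencil_mx Y D - pencil_mx X D).
Proof.
apply/row_matrixP => i; rewrite !rowE mulmxDr -scalemxAr mulmxBr.
rewrite -[delta_mx 0 i]vec_mxK !mul_vec_lin -!linearB -linearZ -linearD /=.
congr mxvec; set V := vec_mx _; rewrite /pencil_map sylv_line.
set a := sylv X D V; set b := sylv Y D V.
have -> : V - b - (V - a) = - (b - a) by rewrite opprB addrC addrA subrK opprB.
by rewrite scalerN opprD addrA.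
Qed.

(* By Cramer's rule S / q solves the pencil equation along the line. *)
Lemma pencil_line_solve n d (X Y : 'I_g -> 'M[k]_n) (D : 'I_g -> 'M[k]_d) U :
  exists (q : {poly k}) (S : 'M[{poly k}]_(n, d)), forall t,
    (pencil_inj (line X Y t) D <-> q.[t] != 0) /\
    S@[t] = q.[t] *: U + sylv (line X Y t) D S@[t].
Proof.
pose L : 'M_(n * d) :=
  map_mx polyC (pencil_mx X D) + 'X *: map_mx polyC (pencil_mx Y D - pencil_mx X D).
have EL t : L@[t] = pencil_mx (line X Y t) D.
  rewrite pencil_mx_line /L; move: (pencil_mx X D) (pencil_mx Y D) => M N.
  by apply/matrixP => a b; rewrite !mxE horner_evalE hornerD hornerM hornerX !hornerC.
exists (\det L), (vec_mx (map_mx polyC (mxvec U) *m \adj L)) => t; split.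
  apply: (iff_trans (pencil_injP _ _)).
  by rewrite unitmxE unitfE -EL det_map_mx.
set S := vec_mx _; apply/eqP; rewrite -subr_eq; apply/eqP.
rewrite -[LHS]/(pencil_map (line X Y t) D S@[t]); apply: (can_inj mxvecK).
rewrite -mul_vec_lin -/(pencil_mx _ _) -EL -map_mxvec vec_mxK -map_mxM.
rewrite -mulmxA mul_adj_mx mul_mx_scalar map_mxZ linearZ /=; congr (_ *: _).
by apply/matrixP => a b; rewrite !mxE horner_evalE hornerC.
Qed.

(** Points of different sizes are brought to a common size by repeating them. [P] collects what must
    survive direct sums; [E] is the inclusion of the first copy, split by [E'], through which
    equations are pulled back. *)
Lemma copies n (X : 'I_g -> 'M[k]_n) (P : forall m, ('I_g -> 'M[k]_m) -> Prop) :
  (forall m1 m2 (Y1 : 'I_g -> 'M_m1) (Y2 : 'I_g -> 'M_m2),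
    P _ Y1 -> P _ Y2 -> P _ (dsum Y1 Y2)) ->
  P _ X -> forall p, exists X' : 'I_g -> 'M[k]_(n * p.+1), P _ X' /\
    exists (E : 'M[k]_(n * p.+1, n)) (E' : 'M[k]_(n, n * p.+1)),
      E' *m E = 1%:M /\ forall s, X' s *m E = E *m X s.
Proof.
move=> Pdsum PX; elim=> [|p [X' [PX' _]]].
  rewrite muln1; exists X; split=> //; exists 1%:M, 1%:M.
  by split=> [|s]; rewrite mulmx1 ?mul1mx.
rewrite mulnS; exists (dsum X X'); split; first exact: Pdsum.
exists (col_mx 1%:M 0), (row_mx 1%:M 0); split=> [|s].
  by rewrite mul_row_col mulmx1 mul0mx addr0.
by rewrite mul_block_col mul_col_mx !mulmx1 !mulmx0 !mul0mx mul1mx !addr0.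
Qed.

End Pencil.

(** * Polynomials in characteristic zero *)

Lemma poly_nonroot (k : fieldType) (p : {poly k}) :
  [pchar k] =i pred0 -> p != 0 -> exists t, p.[t] != 0.
Proof.
move=> /pcharf0P char0 p0; apply: contrapT => H.
have rootp t : root p t by apply/negPn/negP => pt; apply: H; exists t.
(* In characteristic 0 the integers below [size p] would be [size p] distinct roots, one more than
   the degree allows. *)
have := max_poly_roots p0 (rs := [seq n%:R | n <- iota 0 (size p)]).
rewrite size_map size_iota ltnn => /(_ _ _)/notF; apply; first exact/allP.
rewrite map_inj_uniq ?iota_uniq // => m n /eqP.
wlog le_mn : m n / (m <= n)%N.
  by move=> W; case/orP: (leq_total m n) => /W // /[swap]; rewrite eq_sym => /[swap] /[apply].
rewrite eq_sym -subr_eq0 -natrB // char0 subn_eq0 => le_nm.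
by apply/eqP; rewrite eqn_leq le_mn.
Qed.

Lemma poly_eq0_off (k : fieldType) (q p : {poly k}) :
  [pchar k] =i pred0 -> q != 0 ->
  (forall t, q.[t] != 0 -> p.[t] = 0) -> p = 0.
Proof.
move=> char0 q0 H; apply/eqP/negPn/negP => p0.
have [t] := poly_nonroot char0 (mulf_neq0 q0 p0).
by rewrite hornerM mulf_eq0 negb_or => /andP[/H ->]; rewrite eqxx.
Qed.

(** * State-space representations *)

Section Representation.
Variables (k : fieldType) (g : nat).
Hypothesis char0 : [pchar k] =i pred0.
Implicit Types r : ncexpr k g.

Local Notation "P @[ t ]" := (map_mx (horner_eval t) P)
  (at level 2, left associativity, format "P @[ t ]").

(** [V] is the state produced by the input [w], and [V *m c] the output. The output is prescribed
    only where both [r] and the pencil are regular; the first clause supplies such a point, so the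
    condition is not vacuous. *)
Definition represented d r (D : 'I_g -> 'M[k]_d) (b : 'rV[k]_d) (c : 'cV[k]_d) :=
  (exists n (X : 'I_g -> 'M[k]_n), [/\ (0 < n)%N, expr_dom r X & pencil_inj X D]) /\
  forall n (X : 'I_g -> 'M[k]_n) P V w, (0 < n)%N ->
    nceval X r = Some P -> pencil_inj X D ->
    V = w *m b + sylv X D V -> P *m w = V *m c.

(** Here the pencil must be regular on the whole domain of [r]. This form passes to subspaces and
    quotients of the state space, whereas only [represented] is transferred to equivalent
    expressions. *)
Definition strongly_represented d r (D : 'I_g -> 'M[k]_d) (b : 'rV[k]_d)
    (c : 'cV[k]_d) :=
  Defs.nondegenerate r /\
  forall n (X : 'I_g -> 'M[k]_n) P, (0 < n)%N -> nceval X r = Some P ->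
    pencil_inj X D /\ forall V w, V = w *m b + sylv X D V -> P *m w = V *m c.

Lemma strongly_represented_represented d r D (b : 'rV[k]_d) c :
  strongly_represented r D b c -> represented r D b c.
Proof.
move=> [[n [X [n0 dX]]] H]; split.
  exists n, X; split=> //; move: dX; rewrite /expr_dom.
  by case EX: (nceval X r) => [P|] // _; have [] := H _ _ _ n0 EX.
by move=> {n0 dX}n {}X P V w n0 EX _; apply: (H _ _ _ n0 EX).2.
Qed.

Lemma nceq_sym r r' : nceq r r' -> nceq r' r.
Proof. by case=> nr nr' H; split=> // n X n0 dr' dr; rewrite H. Qed.

(* Equivalent expressions may have no common point in a given size. Copies of a
   point of each domain lie in a common size; on the line joining them both
   expressions are regular at all but finitely many points. *)
Lemma represented_nceq d r r' D (b : 'rV[k]_d) c :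
  represented r D b c -> nceq r r' -> represented r' D b c.
Proof.
move=> [[[|N] [Y [// _ dY iY]]] H] [_ nd' Hrr'].
have copyY n' : exists Y' : 'I_g -> 'M[k]_(n'.+1 * N.+1),
    expr_dom r Y' /\ pencil_inj Y' D.
  have := copies (P := fun m (Z : 'I_g -> 'M_m) => expr_dom r Z /\ pencil_inj Z D)
    _ (conj dY iY) n'; rewrite mulnC.
  case=> [m1 m2 Y1 Y2 [d1 i1] [d2 i2]|Y' [? _]]; last by exists Y'.
  by split; [apply: expr_dom_dsum | apply: pencil_inj_dsum].
split=> [|[//|n] X P V w _ EX iX EV].
  (* A common point of [r'] and the pencil is sought on the line from copies of a point of [r'] to
     copies of [Y], off the zeros of two nonzero polynomials. *)
  have [[|n] [X [// _ dX]]] := nd'.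
  have [Y' [dY' iY']] := copyY n.
  have [|X' [dX' _]] := copies (P := fun m (Z : 'I_g -> 'M_m) => expr_dom r' Z) _ dX N.
    by move=> m1 m2 Y1 Y2; apply: expr_dom_dsum.
  have dX0 : expr_dom r' (line X' Y' 0) by rewrite line0.
  have [q1 [P1 [q10 H1]]] := nceval_line dX0.
  have [q2 [S H2]] := pencil_line_solve X' Y' D 0.
  have q2n0 : q2.[1] != 0 by apply/(H2 1).1; rewrite line1.
  have [|t] := @poly_nonroot k (q1 * q2) char0.
    by apply: mulf_neq0; [apply: contraNneq q10 | apply: contraNneq q2n0] => ->;
      rewrite horner0.
  rewrite hornerM mulf_eq0 negb_or => /andP[q1t q2t].
  exists (n.+1 * N.+1)%N, (line X' Y' t); split=> //; last exact/(H2 t).1.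
  by rewrite /expr_dom (H1 _ q1t).
have [Y' [dY' iY']] := copyY n.
have dX : expr_dom r' X by rewrite /expr_dom EX.
have [|X' [[dX' iX'] [E [E' [EE' HE]]]]] :=
  copies (P := fun m (Z : 'I_g -> 'M_m) => expr_dom r' Z /\ pencil_inj Z D)
    _ (conj dX iX) N.
  move=> m1 m2 Y1 Y2 [d1 i1] [d2 i2].
  by split; [apply: expr_dom_dsum | apply: pencil_inj_dsum].
set m := (_ * _)%N in X' dX' iX' E E' EE' HE Y' dY' iY'.
have [P' EX'] : exists P', nceval X' r' = Some P'.
  by move: dX'; rewrite /expr_dom; case: nceval => // P' _; exists P'.
(* As [E] has a left inverse, the identity may be checked at the copies [X']. *)
suff HP : P' *m (E *m w) = E *m V *m c.
  rewrite -[P *m w]mul1mx -[V *m c]mul1mx -EE' -!mulmxA; congr (_ *m _).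
  by rewrite !mulmxA -(nceval_intertwine HE EX EX') -!mulmxA HP mulmxA.
have {HE} : E *m V = (E *m w) *m b + sylv X' D (E *m V).
  by rewrite (sylv_intertwine _ _ HE) -mulmxA -mulmxDr -EV.
move: (E *m V) (E *m w) => {P EX iX dX EV EE' E E'}V' w' {V w}.
have dX0 : expr_dom r' (line X' Y' 0) by rewrite line0.
have dY1 : expr_dom r (line X' Y' 1) by rewrite line1.
have [q1 [P1 [q10 H1]]] := nceval_line dX0.
have [q2 [P2 [q20 H2]]] := nceval_line dY1.
have [q3 [S H3]] := pencil_line_solve X' Y' D (w' *m b).
have q30 : q3.[0] != 0 by apply/(H3 0).1; rewrite line0.
have scaleS t : q3.[t] != 0 ->
    q3.[t]^-1 *: S@[t] = w' *m b + sylv (line X' Y' t) D (q3.[t]^-1 *: S@[t]).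
  move=> q3t; rewrite linearZ {1}(H3 t).2 /=.
  by rewrite scalerDr scalerA mulVf // scale1r.
have polyCK t p1 p2 (M : 'M[k]_(p1, p2)) : (map_mx polyC M)@[t] = M.
  by apply/matrixP => x y; rewrite !mxE horner_evalE hornerC.
(* Off the zeros of [q1 * q2 * q3] the values of [r] and [r'] agree and [r] obeys the formula. With
   denominators cleared this is a polynomial identity, hence it also holds at [t = 0], where [r]
   itself may be undefined. *)
have T0 : q3 *: (P1 *m map_mx polyC w') = q1 *: (S *m map_mx polyC c).
  apply/eqP; rewrite -subr_eq0; apply/eqP/matrixP => i j; rewrite [RHS]mxE.
  apply: (@poly_eq0_off _ (q1 * q2 * q3)) => //.
    rewrite !mulf_neq0 //; [move: q10|move: q20|move: q30];
      by apply: contraNneq => ->; rewrite horner0.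
  move=> t; rewrite !hornerM !mulf_eq0 !negb_or => /andP[/andP[q1t q2t] q3t].
  have it : pencil_inj (line X' Y' t) D by apply/(H3 t).1.
  have Er := H2 _ q2t; have Er' := H1 _ q1t.
  have := H _ _ _ _ w' isT Er it (scaleS t q3t).
  have := Hrr' _ (line X' Y' t) isT; rewrite /expr_dom Er Er' => /(_ isT isT)[->].
  rewrite -!scalemxAl => /(congr1 ( *:%R (q1.[t] * q3.[t]))).
  rewrite !scalerA mulrAC mulfV // mul1r mulfK // => HT.
  suff /matrixP/(_ i j): (q3 *: (P1 *m map_mx polyC w')
      - q1 *: (S *m map_mx polyC c))@[t] = 0 by rewrite [LHS]mxE [RHS]mxE.
  rewrite map_mxB !map_mxZ !map_mxM /= !polyCK !horner_evalE.
  by apply/eqP; rewrite subr_eq0; apply/eqP.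
move=> EV'; have := congr1 (map_mx (horner_eval 0)) T0.
rewrite !map_mxZ !map_mxM /= !polyCK !horner_evalE.
have := H1 _ q10; rewrite line0 EX' => -[->].
have := scaleS _ q30; rewrite line0 => /(pencil_uniq iX' EV') ->.
rewrite -!scalemxAl => HT; apply: (scalerI (mulf_neq0 q10 q30)).
by rewrite !scalerA mulrAC mulfV // mul1r mulfK.
Qed.

End Representation.

(** * Realizations and their reduction to controllable and observable ones *)

Section Realization.
Variables (k : fieldType) (g : nat).

Lemma mulmx_sum_col m n (A : 'M[k]_(m, n)) (u : 'cV_n) :
  A *m u = \sum_j u j 0 *: col j A.
Proof.
apply/matrixP => x y; rewrite ord1 mxE summxE; apply: eq_bigr => j _.
by rewrite !mxE mulrC.
Qed.

Lemma nceval_const n (X : 'I_g -> 'M[k]_n) a :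
  nceval X (NCPoly a%:MP) = Some a%:M.
Proof. by rewrite /nceval ncpoly_evalC. Qed.

Lemma nceval_mul n (X : 'I_g -> 'M[k]_n) (r1 r2 : ncexpr k g) P1 P2 :
  nceval X r1 = Some P1 -> nceval X r2 = Some P2 ->
  nceval X (NCMul r1 r2) = Some (P1 *m P2).
Proof. by move=> /= -> ->. Qed.

Lemma nceval_scal n (X : 'I_g -> 'M[k]_n) a b (r : ncexpr k g) P :
  nceval X r = Some P ->
  nceval X (NCMul (NCMul (NCPoly a%:MP) r) (NCPoly b%:MP)) = Some ((a * b) *: P).
Proof.
move=> EP; rewrite (nceval_mul (nceval_mul (nceval_const X a) EP) (nceval_const X b)).
by rewrite mul_scalar_mx mul_mx_scalar scalerA mulrC.
Qed.

(** The value at [X] of the inverse matrix solves the state equation explicitly, which gives both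
    injectivity of the pencil and the output formula. *)
Lemma realization_strongly_represented d (F : ncratfun k g)
    (c : 'cV[k]_d) (A : 'I_g -> 'M[k]_d) (b : 'cV[k]_d) :
  realization F c A b ->
  exists2 r, F r & strongly_represented r (fun s => (A s)^T) b^T c.
Proof.
move=> [_ [M invM Fr]]; eexists; first exact: Fr; split.
  by have [r0 _ H] := represents_class F; have [] := (H _).1 Fr.
move=> n X P n0 EP.
(* The default 0 is never taken: each [M i j] is a subexpression of the realization expression,
   which has a value at [X]. *)
pose m i j := odflt 0 (nceval X (M i j)).
have Em i j : nceval X (M i j) = Some (m i j).
  have [v Hv _] := nceval_ncsumE EP; have [u Hu _] := nceval_ncsumE (Hv i).
  by move: (Hu j) => /=; rewrite /m; case: (nceval X (M i j)).
have {EP} -> : P = \sum_i \sum_j (c i 0 * b j 0) *: m i j.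
  apply: Some_inj; rewrite -EP; apply: nceval_ncsum => i.
  apply: nceval_ncsum => j; exact: nceval_scal.
have mL i j : \sum_l m i l *m ncpoly_eval X (pencil A l j) = (i == j)%:R%:M.
  have [_ _ H] := (invM i j).2; have {H} := H n X n0.
  rewrite /expr_dom (nceval_ncsum (v := fun l => m i l *m ncpoly_eval X (pencil A l j)));
    last by move=> l /=; rewrite Em.
  by move=> /(_ isT isT)[->]; rewrite ncpoly_eval_bool.
(* Column [i] of [V] results from multiplying the columns of [V - sylv V = U] by row [i] of the
   inverse. *)
have colV U V : V = U + sylv X (fun s => (A s)^T) V ->
    forall i, col i V = \sum_l m i l *m col l U.
  move=> EV i; have {EV} -> : U = V - sylv X (fun s => (A s)^T) V by rewrite {1}EV addrK.
  have -> : col i V = \sum_j (i == j)%:R%:M *m col j V.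
    rewrite (bigD1 i) //= eqxx mul1mx big1 ?addr0 // => j.
    by rewrite eq_sym => /negPf->; rewrite mul_scalar_mx scale0r.
  under eq_bigr do rewrite -mL mulmx_suml.
  rewrite exchange_big; apply: eq_bigr => l _.
  under eq_bigr do rewrite -mulmxA.
  rewrite -mulmx_sumr; congr (_ *m _).
  under eq_bigr do rewrite ncpoly_eval_pencil mulmxBl.
  rewrite sumrB linearB /=; congr (_ - _).
    rewrite (bigD1 l) //= eqxx mul1mx big1 ?addr0 // => j.
    by rewrite eq_sym => /negPf->; rewrite mul_scalar_mx scale0r.
  rewrite /sylv linear_sum; under eq_bigr do rewrite mulmx_suml.
  rewrite exchange_big; apply: eq_bigr => s _ /=.
  rewrite [RHS]colE -!mulmxA -[_^T *m _]colE [V *m _]mulmx_sum_col mulmx_sumr.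
  apply: eq_bigr => j _.
  by rewrite !mxE -scalemxAl scalemxAr.
split=> [V EV|V w /colV EV].
  apply/matrixP => x i; rewrite mxE.
  have /matrixP/(_ x 0) : col i V = 0.
    by rewrite (colV 0) ?add0r // big1 // => l _; rewrite linear0 mulmx0.
  by rewrite !mxE.
rewrite [V *m c]mulmx_sum_col mulmx_suml; apply: eq_bigr => i _.
rewrite EV scaler_sumr mulmx_suml; apply: eq_bigr => j _.
rewrite -scalemxAl -scalerA scalemxAr; congr (_ *: (_ *m _)).
by apply/matrixP => x y; rewrite !mxE big_ord1 mxE ord1 mulrC.
Qed.

(** [R] includes an invariant subspace containing [b]: a solution [V] for [D'] yields the solution
    [V *m R] for [D]. *)
Lemma strongly_represented_sub d e r (D : 'I_g -> 'M[k]_d) b c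
    (D' : 'I_g -> 'M[k]_e) (b' : 'rV[k]_e) (R : 'M[k]_(e, d)) :
  row_free R -> (forall s, D' s *m R = R *m D s) -> b = b' *m R ->
  strongly_represented r D b c -> strongly_represented r D' b' (R *m c).
Proof.
move=> freeR DR Eb [ndr H]; split=> // n X P n0 EX; have [inj HV] := H n X P n0 EX.
split=> [V EV|V w EV].
  apply: (row_free_injr freeR) => /=; rewrite mul0mx; apply: inj.
  by rewrite (sylvM _ _ DR) -EV.
by rewrite mulmxA; apply: HV; rewrite (sylvM _ _ DR) Eb mulmxA -mulmxDl -EV.
Qed.

(** Solutions for [D] are pushed forward along [Q]. Surjectivity of the pencil is what descends to a
    quotient, and in finite dimension it gives back injectivity. *)
Lemma strongly_represented_quot d e r (D : 'I_g -> 'M[k]_d) b c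
    (D' : 'I_g -> 'M[k]_e) (c' : 'cV[k]_e) (Q : 'M[k]_(d, e)) :
  row_full Q -> (forall s, D s *m Q = Q *m D' s) -> c = Q *m c' ->
  strongly_represented r D b c -> strongly_represented r D' (b *m Q) c'.
Proof.
move=> fullQ DQ Ec [ndr H]; split=> // n X P n0 EX; have [inj HV] := H n X P n0 EX.
have injD' : pencil_inj X D'.
  apply: pencil_surj_inj => U; have [V EV] := pencil_surj inj (U *m pinvmx Q).
  exists (V *m Q); rewrite (sylvM _ _ DQ) {1}EV mulmxDl -mulmxA mulVpmx //.
  by rewrite mulmx1.
split=> // V w EV; have [V' EV'] := pencil_surj inj (w *m b).
have -> : V = V' *m Q.
  apply: (pencil_uniq injD' EV).
  by rewrite (sylvM _ _ DQ) {1}EV' mulmxDl mulmxA.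
by rewrite -mulmxA -Ec; apply: HV.
Qed.

(** Kalman's condition that the products of [b] with words in the [D s] span the whole space, stated
    through invariant subspaces. [observable] is its dual. *)
Definition controllable d (D : 'I_g -> 'M[k]_d) (b : 'rV[k]_d) :=
  forall m (W : 'M[k]_(m, d)), (b <= W)%MS -> (forall s, W *m D s <= W)%MS -> row_full W.

Definition observable d (D : 'I_g -> 'M[k]_d) (c : 'cV[k]_d) :=
  forall m (W : 'M[k]_(m, d)), (forall s, W *m D s <= W)%MS -> W *m c = 0 -> W = 0.

(** Induction on the dimension: a failure of controllability gives a proper invariant subspace to
    restrict to, a failure of observability a nonzero invariant subspace to divide by. *)
Lemma reduce_strongly_represented d r (D : 'I_g -> 'M[k]_d) b c :
  strongly_represented r D b c ->
  exists e (D' : 'I_g -> 'M[k]_e) b' c', [/\ (e <= d)%N,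
    strongly_represented r D' b' c', controllable D' b' & observable D' c'].
Proof.
have [N] := ubnP d; elim: N d D b c => // N IHN d D b c; rewrite ltnS => leN Hr.
have smaller e (D' : 'I_g -> 'M[k]_e) b' c' : (e < d)%N ->
    strongly_represented r D' b' c' ->
    exists e (D' : 'I_g -> 'M[k]_e) b' c', [/\ (e <= d)%N,
    strongly_represented r D' b' c', controllable D' b' & observable D' c'].
  move=> lt_ed /IHN[|f [D2 [b2 [c2 [le_fe H1 H2 H3]]]]]; first exact: leq_trans leN.
  by exists f, D2, b2, c2; split=> //; apply: leq_trans (ltnW lt_ed).
have [ctrl|] := pselect (controllable D b); last first.
  move=> /existsNP[m /existsNP[W /not_implyP[bW /not_implyP[DW nfull]]]].
  pose R := row_base W.
  apply: (smaller _ (fun s => R *m D s *m pinvmx R) (b *m pinvmx R) (R *m c)).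
    by rewrite ltn_neqAle rank_leq_col andbT; apply/negP.
  apply: strongly_represented_sub Hr; first exact: row_base_free.
    by move=> s; rewrite mulmxKpV // eq_row_base (eqmxMr _ (eq_row_base W)).
  by rewrite mulmxKpV // eq_row_base.
have [obs|] := pselect (observable D c); last first.
  move=> /existsNP[m /existsNP[W /not_implyP[DW /not_implyP[Wc Wn0]]]].
  (* The rows of [R] are a basis of the linear forms vanishing on [W], so [R^T] is the quotient map
     by [W]. *)
  pose R := row_base (kermx W^T).
  have RW : R *m W^T = 0 by apply/sub_kermxP; rewrite eq_row_base.
  have DR s : R *m (D s)^T = R *m (D s)^T *m pinvmx R *m R.
    rewrite mulmxKpV // eq_row_base; apply/sub_kermxP.
    have /submxP[Z EZ] := DW s.
    by rewrite -mulmxA -trmx_mul EZ trmx_mul mulmxA RW mul0mx.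
  have /submxP[u Eu] : (c^T <= R)%MS.
    by rewrite eq_row_base; apply/sub_kermxP; rewrite -trmx_mul Wc trmx0.
  apply: (smaller _ (fun s => (R *m (D s)^T *m pinvmx R)^T) (b *m R^T) u^T).
    have rW : (0 < \rank W)%N by rewrite lt0n mxrank_eq0; apply/eqP.
    by rewrite mxrank_ker mxrank_tr ltn_subrL rW (leq_trans rW (rank_leq_col W)).
  apply: strongly_represented_quot Hr.
  - by rewrite /row_full mxrank_tr; exact: row_base_free.
  - by move=> s; apply: trmx_inj; rewrite !trmx_mul !trmxK.
  - by apply: trmx_inj; rewrite trmx_mul !trmxK.
by exists d, D, b, c.
Qed.

End Realization.

(** * Nilpotency of the coefficients *)

Section Nilpotency.
Variables (k : fieldType) (g e : nat).
Variables (D : 'I_g -> 'M[k]_e) (b : 'rV[k]_e) (c : 'cV[k]_e).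

Local Notation "P @[ t ]" := (map_mx (horner_eval t) P)
  (at level 2, left associativity, format "P @[ t ]").

Definition reached j (V : 'M[k]_(j, e)) :=
  exists (Y : 'I_g -> 'M[k]_j) w, V = w *m b + sylv Y D V /\ pencil_inj Y D.

(** The new point has a zero last block column: the added row depends on the old rows only, so the
    equation is solved by substitution and the pencil stays injective. *)
Lemma reached_col_mx j (V : 'M[k]_(j, e)) (u : 'rV_e) z (L : 'I_g -> 'rV_j) :
  reached V -> u = z *m b + \sum_s L s *m V *m D s -> reached (col_mx V u).
Proof.
move=> [Y [w [EV iY]]] Eu; pose Y' s : 'M_(j + 1) := block_mx (Y s) 0 (L s) 0.
have EY' U1 U2 : sylv Y' D (col_mx U1 U2) =
    col_mx (sylv Y D U1) (\sum_s L s *m U1 *m D s).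
  rewrite /sylv; elim/big_rec3: _ => [|s M1 M2 M3 _ ->]; first by rewrite col_mx0.
  by rewrite -add_col_mx mul_block_col !mul0mx !addr0 mul_col_mx.
exists Y', (col_mx w z); rewrite EY' mul_col_mx add_col_mx -EV -Eu; split=> // U.
rewrite -[U]vsubmxK EY' => /eq_col_mx[/iY-> ->].
by rewrite big1 ?col_mx0 // => s _; rewrite mulmx0 mul0mx.
Qed.

Lemma row_free_col_mx j (V : 'M[k]_(j, e)) (u : 'rV_e) :
  row_free V -> ~~ (u <= V)%MS -> row_free (col_mx V u).
Proof.
move=> freeV; apply: contraR => nfree.
suff : (col_mx V u <= V)%MS by rewrite col_mx_sub => /andP[].
have VVu : (V <= col_mx V u)%MS.
  by have := submx_refl (col_mx V u); rewrite col_mx_sub => /andP[].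
rewrite -(geq_leqif (mxrank_leqif_sup VVu)) (eqP freeV) -ltnS -[j.+1]addn1.
by rewrite ltn_neqAle rank_leq_row andbT.
Qed.

(** A reached matrix [V] with independent rows and as many of them as possible has a row space that
    contains [b] and is invariant, so it is everything by controllability. *)
Lemma controllable_frame : controllable D b ->
  exists (Y : 'I_g -> 'M[k]_e) w, 1%:M = w *m b + sylv Y D 1%:M /\ pencil_inj Y D.
Proof.
move=> ctrl.
pose P j := `[< exists2 V : 'M[k]_(j, e), row_free V & reached V >].
have P0 : exists j, P j.
  exists 0%N; apply/asboolP; exists 0; first by rewrite /row_free mxrank0.
  by exists (fun=> 0), 0; split=> [|V _]; [rewrite [RHS]flatmx0 | exact: flatmx0].
have Ple j : P j -> (j <= e)%N.
  by move=> /asboolP[V freeV _]; rewrite -(eqP freeV) rank_leq_col.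
case: (ex_maxnP P0 Ple) => j /asboolP[V freeV rV] maxj.
have sub (u : 'rV_e) z L : u = z *m b + \sum_s L s *m V *m D s -> (u <= V)%MS.
  move=> Eu; have rVu := reached_col_mx rV Eu.
  apply/negPn/negP => /(row_free_col_mx freeV) fVu.
  have Pj1 : P (j + 1)%N by apply/asboolP; exists (col_mx V u).
  by have := maxj _ Pj1; rewrite addn1 ltnn.
have fullV : row_full V.
  apply: ctrl => [|s].
    apply: (sub _ 1%:M (fun=> 0)); rewrite mul1mx big1 ?addr0 // => s _.
    by rewrite !mul0mx.
  (* These coefficients single out row [i] of [V *m D s]. *)
  apply/row_subP => i; apply: (sub _ 0 (fun s' => (s' == s)%:R *: delta_mx 0 i)).
  rewrite mul0mx add0r (bigD1 s) //= eqxx scale1r big1 ?addr0 => [|s' /negPf->].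
    by rewrite -mulmxA -rowE.
  by rewrite scale0r !mul0mx.
have Ej : j = e by rewrite -(eqP freeV) (eqP fullV).
subst j; case: rV => Y [w [EV iY]]; have uV : V \in unitmx by rewrite -row_free_unit.
(* Conjugation by [V] turns the state [V] into the identity. *)
pose Y' s := invmx V *m Y s *m V.
have HY s : Y s *m V = V *m Y' s by rewrite !mulmxA mulmxV // mul1mx.
exists Y', (invmx V *m w); split=> [|U EU].
  rewrite -{1}(mulVmx uV) {2}EV mulmxDr mulmxA; congr (_ + _).
  rewrite mulmx_sumr; apply: eq_bigr => s _.
  by rewrite mulmx1 !mulmxA.
apply: (can_inj (mulKmx uV)); rewrite mulmx0; apply: iY.
by rewrite (sylv_intertwine _ _ HY) -EU.
Qed.

(** The residue argument. Since the function is only known to be regular in size [e + p], points of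
    size [e] are padded with a zero block of size [p]. *)
Lemma fixed_subspace_pole (F : ncexpr k g -> Prop) p (W : 'M[k]_e) :
  [pchar k] =i pred0 -> (0 < e + p)%N -> controllable D b ->
  (forall r, F r -> represented r D b c) ->
  (forall X : 'I_g -> 'M[k]_(e + p), exists2 r, F r & expr_dom r X) ->
  (W <= \sum_s W *m D s)%MS -> W *m c = 0.
Proof.
move=> char0 n0 /controllable_frame[Y [w [EY iY]]] FD dom WD.
(* A projection onto the row space of [W]. *)
pose pi := pinvmx W *m W.
have Wpi : W *m pi = W by rewrite mulmxA mulmxKpV.
have pipi : pi *m pi = pi by rewrite {1}/pi -mulmxA Wpi.
have [u Eu] : exists u : 'I_g -> 'M_e, pi = \sum_s u s *m (W *m D s).
  by apply/sub_sumsmxP; apply: submx_trans WD; exact: submxMl.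
pose X s := u s *m W.
have EX : pi = \sum_s X s *m D s by rewrite {1}Eu; apply: eq_bigr => s _; rewrite mulmxA.
have Xpi s : X s *m pi = X s by rewrite -mulmxA Wpi.
pose T s := Y s *m (1%:M - pi) + X s.
pose V t := 1%:M - pi + t^-1 *: pi.
have EV t : t != 0 -> V t = w *m b + sylv (line T Y t) D (V t).
  move=> t0.
  (* Indeed [line T Y t s *m V t] equals [Y s + (t^-1 - 1) *: X s]. *)
  have -> : sylv (line T Y t) D (V t) = sylv Y D 1%:M + (t^-1 - 1) *: pi.
    rewrite EX scaler_sumr -big_split; apply: eq_bigr => s _ /=.
    rewrite mulmx1 scalemxAl -mulmxDl; congr mulmx.
    have YV : Y s *m V t = Y s *m (1%:M - pi) + t^-1 *: (Y s *m pi).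
      by rewrite mulmxDr -scalemxAr.
    have TV : T s *m V t = Y s *m (1%:M - pi) + t^-1 *: X s.
      have Qpi : (1%:M - pi) *m pi = 0 by rewrite mulmxBl mul1mx pipi subrr.
      have QQ : (1%:M - pi) *m (1%:M - pi) = 1%:M - pi.
        by rewrite mulmxBr mulmx1 Qpi subr0.
      have XQ : X s *m (1%:M - pi) = 0 by rewrite mulmxBr mulmx1 Xpi subrr.
      rewrite /T /V; move: (1%:M - pi) Qpi QQ XQ => Q Qpi QQ XQ.
      rewrite mulmxDl !mulmxDr -!scalemxAr -!(mulmxA (Y s)) Qpi QQ XQ Xpi.
      by rewrite mulmx0 scaler0 addr0 add0r.
    rewrite /line mulmxDl -scalemxAl mulmxBl YV TV.
    rewrite opprD addrACA subrr add0r scalerBr !scalerA mulfV // !scale1r.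
    rewrite mulmxBr mulmx1 scalerBl scale1r [X in X = _]addrACA subrK.
    by rewrite [t^-1 *: _ - _]addrC.
  rewrite addrA -EY scalerBl scale1r /V -!addrA; congr (_ + _).
  by rewrite addrC.
have [r Fr dr] := dom (dsum T (fun=> 0 : 'M_p)).
have [_ Hr] := FD r Fr.
pose Z0 := dsum T (fun=> 0 : 'M_p); pose Z1 := dsum Y (fun=> 0 : 'M_p).
have EZ t : line Z0 Z1 t = dsum (line T Y t) (fun=> 0).
  apply: funext => s; rewrite /line /Z0 /Z1 /dsum opp_block_mx add_block_mx.
  by rewrite scale_block_mx add_block_mx !subrr !scaler0 !addr0.
have dr0 : expr_dom r (line Z0 Z1 0) by rewrite line0.
have [q1 [P1 [q10 H1]]] := nceval_line dr0.
(* Only [q2], which detects where the pencil is regular, is wanted here, so the right-hand side 0 is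
   as good as any. *)
have [q2 [S H2]] := pencil_line_solve Z0 Z1 D 0.
have q2n : q2.[1] != 0.
  apply/(H2 1).1; rewrite line1; apply: pencil_inj_dsum => // U ->.
  by rewrite /sylv big1 // => s _; rewrite !mul0mx.
pose w' := col_mx w (0 : 'cV_p).
(* This is [t] times the padded output [V t *m c], a polynomial in [t] whose value at 0 is the
   residue [pi *m c]. *)
pose Vc : 'cV[{poly k}]_(e + p) := 'X *: map_mx polyC (col_mx ((1%:M - pi) *m c) 0)
  + map_mx polyC (col_mx (pi *m c) 0).
have polyCK t p1 p2 (M : 'M[k]_(p1, p2)) : (map_mx polyC M)@[t] = M.
  by apply/matrixP => x y; rewrite !mxE horner_evalE hornerC.
have VcE t : Vc@[t] = t *: col_mx ((1%:M - pi) *m c) 0 + col_mx (pi *m c) 0.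
  by rewrite map_mxD map_mxZ /= !polyCK horner_evalE hornerX.
have T0 : 'X *: (P1 *m map_mx polyC w') = q1 *: Vc.
  apply/eqP; rewrite -subr_eq0; apply/eqP/matrixP => i j; rewrite [RHS]mxE.
  apply: (@poly_eq0_off _ (q1 * q2 * 'X)) => //.
    rewrite !mulf_neq0 ?polyX_eq0 //; [move: q10|move: q2n];
      by apply: contraNneq => ->; rewrite horner0.
  move=> t; rewrite !hornerM hornerX !mulf_eq0 !negb_or => /andP[/andP[q1t q2t] t0].
  suff /matrixP/(_ i j): ('X *: (P1 *m map_mx polyC w') - q1 *: Vc)@[t] = 0.
    by rewrite [LHS]mxE [RHS]mxE.
  rewrite map_mxB !map_mxZ !map_mxM /= polyCK VcE !horner_evalE hornerX.
  apply/eqP; rewrite subr_eq0; apply/eqP.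
  have it : pencil_inj (line Z0 Z1 t) D by apply/(H2 t).1.
  have EV' : col_mx (V t) 0 = w' *m b + sylv (line Z0 Z1 t) D (col_mx (V t) 0).
    rewrite EZ sylv_dsum mul_col_mx add_col_mx -EV // mul0mx add0r.
    by rewrite linear0.
  have := Hr _ _ _ _ _ n0 (H1 _ q1t) it EV'.
  rewrite -scalemxAl => /(congr1 ( *:%R (q1.[t] * t))).
  rewrite scalerA mulrAC mulfV // mul1r => ->; rewrite -scalerA; congr (_ *: _).
  rewrite mul_col_mx mul0mx !scale_col_mx scaler0 add_col_mx addr0; congr col_mx.
  by rewrite !scalemxAl -mulmxDl scalerDr scalerA mulfV // scale1r.
(* At [t = 0] the left side vanishes, while [q1.[0]] is nonzero because [r] is defined at that
   point. *)
have := congr1 (map_mx (horner_eval 0)) T0.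
rewrite !map_mxZ VcE /= !horner_evalE hornerX !scale0r add0r.
move/esym/eqP; rewrite scaler_eq0 (negPf q10) -col_mx0 => /eqP /eq_col_mx[pic _].
by rewrite -Wpi -mulmxA pic mulmx0.
Qed.

(** * Vanishing of long words in the coefficients *)

Definition power_space n := iter n (fun W : 'M_e => (\sum_s W *m D s)%MS) 1%:M.

Hypothesis no_fixed_subspace : forall W : 'M[k]_e,
  (W <= \sum_s W *m D s)%MS -> (forall s, W *m D s <= W)%MS -> W = 0.

(** The chain decreases. A step without loss of rank exhibits a fixed invariant subspace, which is
    zero; otherwise the rank drops, which can happen at most [e] times. *)
Lemma power_space_eq0 : power_space e = 0.
Proof.
have desc n : (power_space n.+1 <= power_space n)%MS.
  elim: n => [|n IHn]; first exact: submx1.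
  by apply: sumsmxS => s _; apply: submxMr.
suff rk n : (\rank (power_space n) <= e - n)%N.
  by apply/eqP; rewrite -mxrank_eq0 -leqn0 -(subnn e) rk.
elim: n => [|n IHn]; first by rewrite subn0 rank_leq_col.
have := mxrank_leqif_sup (desc n).
case: (boolP (power_space n <= power_space n.+1)%MS) => [fixed _|_ lt].
  suff W0 : power_space n = 0.
    rewrite /power_space iterS -/(power_space n) W0 big1 ?mxrank0 // => s _.
    by rewrite mul0mx.
  apply: no_fixed_subspace fixed _ => s; apply: submx_trans (desc n).
  by apply: (sumsmx_sup s).
rewrite subnS -ltnS; apply: leq_trans (leqSpred _); apply: leq_trans IHn.
by rewrite (ltn_leqif lt).
Qed.

Lemma sylv_nilpotent n (X : 'I_g -> 'M[k]_n) (V : 'M_(n, e)) :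
  iter e (sylv X D) V = 0.
Proof.
suff H j : (iter j (sylv X D) V <= power_space j)%MS.
  by apply/eqP; rewrite -submx0 -power_space_eq0.
elim: j => [|j IHj]; first exact: submx1.
apply: summx_sub => s _; apply: (sumsmx_sup s) => //.
by apply: submxMr; apply: mulmx_sub.
Qed.

Lemma pencil_inj_nilpotent n (X : 'I_g -> 'M[k]_n) : pencil_inj X D.
Proof.
move=> V EV; have iterV j : iter j (sylv X D) V = V.
  by elim: j => // j IHj; rewrite iterS IHj -EV.
by rewrite -(iterV e) sylv_nilpotent.
Qed.

(** * The polynomial given by the truncated power series *)

Fixpoint words n : seq (seq 'I_g) :=
  if n is n'.+1 then [seq s :: u | s <- index_enum 'I_g, u <- words n'] else [:: [::]].

Lemma size_words n u : u \in words n -> size u = n.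
Proof.
elim: n u => [|n IHn] u /=; first by rewrite inE => /eqP->.
by case/allpairsP=> -[s v] /= [_ /IHn <- ->].
Qed.

(** The order is reversed because iterating [sylv] adds each new [X s] on the left and each new
    [D s] on the right. *)
Definition revprod (u : seq 'I_g) := foldr (fun s M => M *m D s) 1%:M u.

Lemma iter_sylv n (X : 'I_g -> 'M[k]_n) (V : 'M_(n, e)) j :
  iter j (sylv X D) V =
  \sum_(u <- words j) (\prod_(i <- u) X i) *m V *m revprod u.
Proof.
elim: j => [|j IHj] /=; first by rewrite big_seq1 big_nil mul1mx mulmx1.
rewrite big_allpairs_dep /= IHj; apply: eq_bigr => s _.
rewrite mulmx_sumr mulmx_suml; apply: eq_bigr => u _.
by rewrite big_cons -!mulmxE !mulmxA.
Qed.

Definition ncpoly_of : ncpoly k g :=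
  \sum_(j < e) \sum_(u <- words j) << (b *m revprod u *m c) 0 0 *g FMonom u >>.

(** [mmeasure] is one more than the degree, so words of length less than [e] give the bound [e]. *)
Lemma ncdeg_ncpoly_of : (ncdeg ncpoly_of <= e.-1)%N.
Proof.
suff H : (mmeasure (@fdeg 'I_g) ncpoly_of <= e)%N.
  by rewrite /ncdeg -!subn1 leq_sub2r.
apply: leq_trans (mmeasure_sum _ _ _ _) _; apply/bigmax_leqP => j _.
apply: leq_trans (mmeasure_sum _ _ _ _) _; apply/bigmax_leqP_seq => u uj _.
rewrite mmeasureE msuppU; case: ifP => _; first by rewrite big_seq_fset0.
by rewrite big_seq_fset1 /= /fdeg /= (size_words uj).
Qed.

(** By nilpotency the Neumann series of the state equation stops after [e] terms, and its output is
    the value of the polynomial. *)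
Lemma ncpoly_of_eval n (X : 'I_g -> 'M[k]_n) (w : 'cV_n) :
  exists2 V, V = w *m b + sylv X D V & ncpoly_eval X ncpoly_of *m w = V *m c.
Proof.
exists (\sum_(j < e) iter j (sylv X D) (w *m b)).
  set U := w *m b.
  suff H j : \sum_(i < j) iter i (sylv X D) U + iter j (sylv X D) U =
      U + sylv X D (\sum_(i < j) iter i (sylv X D) U).
    by rewrite -H sylv_nilpotent addr0.
  elim: j => [|j IHj]; first by rewrite !big_ord0 linear0 addr0 add0r.
  by rewrite !big_ord_recr /= linearD addrA -IHj.
rewrite /ncpoly_of raddf_sum !mulmx_suml; apply: eq_bigr => j _ /=.
rewrite raddf_sum iter_sylv !mulmx_suml; apply: eq_bigr => u _ /=.
by rewrite ncpoly_evalU -scalemxAl -mul_mx_scalar -mx11_scalar !mulmxA.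
Qed.

End Nilpotency.

(** * The test size is at least [d], and the conclusion *)

Lemma lambda_ge d : (d <= lambda d)%N.
Proof.
rewrite /lambda; case: ifPn => [//|]; rewrite -ltnNge => d1.
set x : realalg := _ - 2; pose D : realalg := d%:R.
have D2 : 2 <= D by rewrite ler_nat.
have D1 : 0 < D - 1 by rewrite subr_gt0; apply: lt_le_trans D2; rewrite ltr1n.
have x_ge : D <= x.
  (* With the root at least 2, [x] is at least [2 * D + D / 2 - 2], which exceeds [D] as soon as [D]
     is at least 2. *)
  have sqrt_ge2 : 2 <= Num.sqrt (2 * D ^+ 2 / (D - 1) + 1 / 4).
    have E : Num.sqrt (2 ^+ 2) = 2 :> realalg by rewrite sqrtr_sqr ger0_norm.
    rewrite -[X in X <= _]E ler_wsqrtr // -[X in X <= _]addr0.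
    rewrite lerD ?divr_ge0 //.
    rewrite ler_pdivlMr // -subr_ge0.
    have -> : 2 * D ^+ 2 - 2 ^+ 2 * (D - 1) = D ^+ 2 + (D - 2) ^+ 2 by ring.
    by rewrite addr_ge0 // sqr_ge0.
  rewrite /x -/D; have D0 : 0 <= D by apply: le_trans D2.
  have := ler_wpM2l D0 sqrt_ge2; lra.
have : (d%:Z <= Num.ceil x)%R.
  by rewrite -(ler_int realalg) (le_trans x_ge) // ceil_ge.
by case: (Num.ceil x) => // n; rewrite lez_nat.
Qed.

Lemma test_size_ge (k : fieldType) d : (d <= test_size k d)%N.
Proof.
rewrite /test_size; have := lambda_ge d; case: ifP => // _ le_d; case: ifP => _.
  by rewrite (leq_trans le_d) // leq_pmull.
case: d le_d => // d le_d; rewrite leq_pmulr // expn_gt0.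
by rewrite (leq_trans _ le_d).
Qed.

Theorem theorem4p2 (k : fieldType) (g d : nat) (F : ncratfun k g)
    (c : 'cV[k]_d) (A : 'I_g -> 'M[k]_d) (b : 'cV[k]_d) :
  [pchar k] =i pred0 ->
  regular_at_origin F ->
  minimal_realization F c A b ->
  (forall X : 'I_g -> 'M[k]_(test_size k d), ratfun_dom F X) ->
  exists2 p : ncpoly k g, F (NCPoly p) & (ncdeg p <= d.-1)%N.
Proof.
move=> char0 _ [realF _] dom; have d_gt0 : (0 < d)%N by case: realF.
have [rho Frho Hrho] := realization_strongly_represented realF.
have [e [D [b' [c' [le_ed Hr ctrl obs]]]]] := reduce_strongly_represented Hrho.
have [r0 nd0 Fr0] := represents_class F.
(* From the realization expression the representation passes to the chosen [r0], and from there to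
   every representative of [F]. *)
have repr0 : represented r0 D b' c'.
  apply: (represented_nceq char0 (strongly_represented_represented Hr)).
  exact/nceq_sym/Fr0.
have repr r : F r -> represented r D b' c' by move=> /Fr0; apply: represented_nceq.
have fixed W : (W <= \sum_s W *m D s)%MS -> (forall s, W *m D s <= W)%MS -> W = 0.
  move=> WD DW; apply: (obs _ W DW).
  have le_em := leq_trans le_ed (test_size_ge k d).
  (* The test size is split as [e] plus the size of the padding block. *)
  move: dom; rewrite /ratfun_dom -(subnKC le_em) => domF.
  apply: (fixed_subspace_pole char0 _ ctrl repr domF WD).
  by rewrite subnKC // (leq_trans d_gt0) // test_size_ge.
exists (ncpoly_of D b' c'); last first.
  by apply: leq_trans (ncdeg_ncpoly_of _ _ _) _; rewrite -!subn1 leq_sub2r.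
apply/Fr0; split=> //; first by exists 1%N, (fun=> 0).
move=> n X n_gt0; rewrite /expr_dom; case EX: (nceval X r0) => [P|] // _ _.
(* A representation describes values applied to vectors, so the two matrices are compared column by
   column. *)
congr Some; apply/matrixP => x i; pose w : 'cV[k]_n := delta_mx i 0.
suff /matrixP/(_ x 0) : P *m w = ncpoly_eval X (ncpoly_of D b' c') *m w.
  by rewrite -!colE !mxE.
have [V EV ->] := ncpoly_of_eval b' c' fixed X w.
by apply: (repr0.2 _ _ _ _ _ n_gt0 EX _ EV); apply: pencil_inj_nilpotent.
Qed.
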